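(* Let $(\overline{M},\overline{g},J)$ be a locally metallic (or locally Golden) Riemannian manifold and let $M:=M_{T}\times_f M_{\perp}$ be a warped product semi-invariant submanifold in $\overline{M}$, where $M_{T}$ is an invariant submanifold and $M_{\perp}$ is an anti-invariant submanifold in $\overline{M}$. Then $M$ is a non proper warped product submanifold in $\overline{M}$, i.e. the warping function $f$ is constant on the connected components of $M_{T}$.
   Context: Let $p,q$ be positive integers. A metallic Riemannian manifold $(\overline{M},\overline{g},J)$ is a Riemannian manifold with a $(1,1)$-tensor field $J$ satisfying $J^{2}=pJ+qI$ and $\overline{g}(JX,Y)=\overline{g}(X,JY)$ for all vector fields $X,Y$; for $p=q=1$ it is called Golden. It is locally metallic (locally Golden) if $\overline{\nabla}J=0$, where $\overline{\nabla}$ is the Levi-Civita connection of $\overline{g}$. For Riemannian manifolds $(M_1,g_1)$, $(M_2,g_2)$ of positive dimension and a smooth $f:M_1\to(0,\infty)$, the warped product $M_1\times_f M_2$ is $M_1\times M_2$ with metric $g=\pi_1^*g_1+(f\circ\pi_1)^2\pi_2^*g_2$, where $\pi_i$ are the projections. A warped product submanifold $M=M_1\times_f M_2$ of $\overline{M}$ is a warped product isometrically immersed in $(\overline{M},\overline{g})$. Write $D_1,D_2$ for the orthogonal distributions on $M$ tangent to the first and second factor. The factor $M_i$ is invariant in $\overline{M}$ if $J(D_i)=D_i$, and anti-invariant if $J(D_i)\subseteq T^{\perp}M$ (the normal bundle of $M$ in $\overline{M}$). A warped product semi-invariant submanifold is one with one factor invariant and the other anti-invariant. *)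

(* Defs.v *)
From HB Require Import structures.
From mathcomp Require Import all_boot all_order all_algebra.
From mathcomp Require Import all_classical all_reals.
From mathcomp Require Import topology normedtype landau derive.

Set Implicit Arguments.
Unset Strict Implicit.
Unset Printing Implicit Defensive.

Import Order.TTheory GRing.Theory Num.Theory.
Import numFieldNormedType.Exports.

Local Open Scope classical_set_scope.
Local Open Scope ring_scope.

Section Smooth.
Context {R : realType}.
Implicit Types E F : normedModType R.

(* For finite-dimensional E this is the usual class C^k on an open set U: f is
   C^(k+1) iff it is differentiable with C^k directional derivatives.  Only
   finite-dimensional E occur as models of the manifolds of interest. *)
Fixpoint Ck E F (k : nat) (U : set E) (f : E -> F) : Prop :=
  if k is k'.+1 then
    (forall x, U x -> differentiable f x) /\
    (forall v : E, Ck k' U (fun x => 'd f x v))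
  else forall x, U x -> {for x, continuous f}.

Definition smooth_on E F (U : set E) (f : E -> F) : Prop :=
  forall k, Ck k U f.

Lemma near_diff E F (f g : E -> F) (x : E) :
  (\forall y \near x, f y = g y) -> differentiable f x ->
  differentiable g x /\ 'd g x = 'd f x :> (E -> F).
Proof.
move=> fg df.
have fgx : f x = g x by exact: nbhs_singleton fg.
have cdf : continuous ('d f x) by exact: diff_continuous.
have expn : g \o shift x = cst (g x) + 'd f x +o_ 0 id.
  have := diff_locally df => /eqaddoP H; apply/eqaddoP => e e0.
  have fg0 : \forall h \near (0 : E), f (h + x) = g (h + x).
    by have := fg; rewrite (near_shift 0 x) /=; apply: filterS => h /=; rewrite subr0.
  near=> h.
  have -> : (g \o shift x - (cst (g x) + 'd f x)) h =
            (f \o shift x - (cst (f x) + 'd f x)) h.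
    by rewrite /= !fctE /= fgx; congr (_ - _); rewrite -(near fg0 h).
  by near: h; apply: H.
have dE := diff_unique cdf expn.
by split=> //; apply/diff_locallyP; rewrite dE.
Unshelve. all: by end_near. Qed.

Lemma eq_Ck E F k (U : set E) (f g : E -> F) : open U ->
  (forall x, U x -> f x = g x) -> Ck k U f -> Ck k U g.
Proof.
move=> oU; elim: k f g => [|k IH] f g fg /=.
  move=> cf x Ux; have nfg : {near x, f =1 g}.
    by apply: filterS fg _; apply: open_nbhs_nbhs.
  rewrite /prop_for /continuous_at -(fg _ Ux).
  by apply: cvg_trans (cf x Ux); apply: near_eq_cvg.
have nfg x : U x -> \forall y \near x, f y = g y.
  by move=> Ux; apply: filterS fg _; apply: open_nbhs_nbhs.
move=> [df Cdf]; split=> [x Ux|v].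
  by have [] := near_diff (nfg x Ux) (df x Ux).
apply: IH (Cdf v) => x Ux.
by have [_ ->] := near_diff (nfg x Ux) (df x Ux).
Qed.

Lemma openX (T1 T2 : topologicalType) (A : set T1) (B : set T2) :
  open A -> open B -> open (A `*` B).
Proof.
rewrite !openE => oA oB [x y] [/= Ax By].
by exists (A, B) => //; split; [exact: oA|exact: oB].
Qed.

Lemma Ck_prod E1 E2 F1 F2 k (U1 : set E1) (U2 : set E2) (f1 : E1 -> F1)
    (f2 : E2 -> F2) : open U1 -> open U2 -> Ck k U1 f1 -> Ck k U2 f2 ->
  Ck k (U1 `*` U2) (fun u : E1 * E2 => (f1 u.1, f2 u.2)).
Proof.
move=> oU1 oU2; elim: k f1 f2 => [|k IH] f1 f2 /=.
  move=> c1 c2 [x1 x2] [/= U1x U2x]; apply: cvg_pair => /=.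
    by apply: (@cvg_comp _ _ _ fst f1 _ (nbhs x1)); [exact: cvg_fst|exact: c1].
  by apply: (@cvg_comp _ _ _ snd f2 _ (nbhs x2)); [exact: cvg_snd|exact: c2].
move=> [d1 C1] [d2 C2].
have dfst (u : E1 * E2) : is_diff u fst (fst : E1 * E2 -> E1).
  apply: DiffDef; first by apply: linear_differentiable => ?; exact: cvg_fst.
  by apply: diff_lin => ?; exact: cvg_fst.
have dsnd (u : E1 * E2) : is_diff u snd (snd : E1 * E2 -> E2).
  apply: DiffDef; first by apply: linear_differentiable => ?; exact: cvg_snd.
  by apply: diff_lin => ?; exact: cvg_snd.
have dd u : (U1 `*` U2) u -> is_diff u (fun w : E1 * E2 => (f1 w.1, f2 w.2))
    (fun v : E1 * E2 => ('d f1 (u.1) v.1, 'd f2 (u.2) v.2)).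
  move=> [U1u U2u].
  have i1 : is_diff u (f1 \o fst : E1 * E2 -> F1) ('d f1 (u.1) \o fst).
    by apply: is_diff_comp; apply: differentiableP; apply: d1.
  have i2 : is_diff u (f2 \o snd : E1 * E2 -> F2) ('d f2 (u.2) \o snd).
    by apply: is_diff_comp; apply: differentiableP; apply: d2.
  exact: is_diff_pair i1 i2.
split=> [u Uu|v]; first exact: (@ex_diff _ _ _ _ _ _ _ (dd u Uu)).
apply: eq_Ck (IH _ _ (C1 v.1) (C2 v.2)); first exact: openX.
by move=> u Uu; rewrite (@diff_val _ _ _ _ _ _ _ (dd u Uu)).
Qed.

Lemma smooth_on_prod E1 E2 F1 F2 (U1 : set E1) (U2 : set E2) (f1 : E1 -> F1)
    (f2 : E2 -> F2) : open U1 -> open U2 ->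
  smooth_on U1 f1 -> smooth_on U2 f2 ->
  smooth_on (U1 `*` U2) (fun u : E1 * E2 => (f1 u.1, f2 u.2)).
Proof. by move=> ? ? s1 s2 k; apply: Ck_prod. Qed.

End Smooth.

Lemma hausdorff_prod (T1 T2 : topologicalType) :
  hausdorff_space T1 -> hausdorff_space T2 -> hausdorff_space (T1 * T2)%type.
Proof.
move=> h1 h2 [x1 x2] [y1 y2] cl; congr (_, _).
  apply: h1 => A B nA nB.
  have [] := cl (A `*` setT) (B `*` setT).
  - by exists (A, setT) => //; split=> //; exact: filterT.
  - by exists (B, setT) => //; split=> //; exact: filterT.
  by move=> [z1 z2] [[/= Az _] [/= Bz _]]; exists z1.
apply: h2 => A B nA nB.
have [] := cl (setT `*` A) (setT `*` B).
- by exists (setT, A) => //; split=> //; exact: filterT.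
- by exists (setT, B) => //; split=> //; exact: filterT.
by move=> [z1 z2] [[/= _ Az] [/= _ Bz]]; exists z2.
Qed.

Lemma second_countable_prod (T1 T2 : topologicalType) :
  @second_countable T1 -> @second_countable T2 ->
  @second_countable (T1 * T2)%type.
Proof.
move=> [B1 cB1 [oB1 bB1]] [B2 cB2 [oB2 bB2]].
exists ((fun P : set T1 * set T2 => P.1 `*` P.2) @` (B1 `*` B2)).
  by apply: sub_countable (card_image_le _ _) _; apply: countableX.
split=> [_ [[P1 P2] [/= P1B P2B] <-]|[x1 x2] A].
  by apply: openX; [exact: oB1|exact: oB2].
move=> [[A1 A2] [/= nA1 nA2] sA].
have [P1 [P1B P1x] sP1] := bB1 x1 A1 nA1.
have [P2 [P2B P2x] sP2] := bB2 x2 A2 nA2.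
exists (P1 `*` P2); first by split=> //; exists (P1, P2).
by move=> [z1 z2] [/= Pz1 Pz2]; apply: sA; split; [exact: sP1|exact: sP2].
Qed.

Record chart (R : realType) (T : topologicalType) (E : normedModType R) :=
  Chart {
    dom : set T ;
    coord : T -> E ;
    param : E -> T ;
    open_dom : open dom ;
    open_codom : open (coord @` dom) ;
    coordK : forall x, dom x -> param (coord x) = x ;
    coord_continuous : forall x, dom x -> {for x, continuous coord} ;
    param_continuous : forall y, (coord @` dom) y -> {for y, continuous param}
  }.

(* A nonempty smooth manifold modelled on E, given by a (not necessarily
   maximal) smooth atlas, together with a preferred chart around each point. *)
Record manifold (R : realType) (E : normedModType R) := Manifold {
  carrier :> topologicalType ;
  manifold_nonempty : [set: carrier] !=set0 ;
  manifold_hausdorff : hausdorff_space carrier ;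
  manifold_second_countable : @second_countable carrier ;
  atlas : set (chart carrier E) ;
  chart_at : carrier -> chart carrier E ;
  chart_at_atlas : forall x, atlas (chart_at x) ;
  chart_at_dom : forall x, dom (chart_at x) x ;
  atlas_compat : forall c c', atlas c -> atlas c' ->
    smooth_on (coord c @` (dom c `&` dom c')) (coord c' \o param c)
}.

Section Product.
Context {R : realType}.

Lemma open_chart_image (T : topologicalType) (E : normedModType R)
    (c : chart T E) (V : set T) : open V -> open (coord c @` (dom c `&` V)).
Proof.
move=> oV.
have -> : coord c @` (dom c `&` V) = (coord c @` dom c) `&` (param c @^-1` V).
  apply/seteqP; split=> [_ [x [cx Vx] <-]|_ [[x cx <-] /= Vx]].
    by split; [exists x|rewrite /= coordK].
  by rewrite coordK // in Vx; exists x.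
rewrite openE => y [cy Vy]; apply: filterI.
  by apply: open_nbhs_nbhs; split=> //; exact: open_codom.
by apply: (param_continuous cy); apply: open_nbhs_nbhs.
Qed.

Lemma image_prod (T1 T2 S1 S2 : Type) (f1 : T1 -> S1) (f2 : T2 -> S2)
    (A1 : set T1) (A2 : set T2) :
  (fun x : T1 * T2 => (f1 x.1, f2 x.2)) @` (A1 `*` A2) =
  (f1 @` A1) `*` (f2 @` A2).
Proof.
apply/seteqP; split=> [_ [[x1 x2] [/= Ax1 Ax2] <-]|[_ _] [/= [x1 ? <-] [x2 ? <-]]].
  by split; [exists x1|exists x2].
by exists (x1, x2).
Qed.

Lemma continuous_prod (T1 T2 S1 S2 : topologicalType) (f1 : T1 -> S1)
    (f2 : T2 -> S2) (x : T1 * T2) :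
  {for x.1, continuous f1} -> {for x.2, continuous f2} ->
  {for x, continuous (fun x : T1 * T2 => (f1 x.1, f2 x.2))}.
Proof.
case: x => x1 x2 /= c1 c2; apply: cvg_pair => /=.
  by apply: (@cvg_comp _ _ _ fst f1 _ (nbhs x1)); [exact: cvg_fst|exact: c1].
by apply: (@cvg_comp _ _ _ snd f2 _ (nbhs x2)); [exact: cvg_snd|exact: c2].
Qed.

Section ProductChart.
Variables (T1 T2 : topologicalType) (E1 E2 : normedModType R).
Variables (c1 : chart T1 E1) (c2 : chart T2 E2).

Let pdom : set (T1 * T2) := dom c1 `*` dom c2.
Let pcoord (x : T1 * T2) : E1 * E2 := (coord c1 x.1, coord c2 x.2).
Let pparam (y : E1 * E2) : T1 * T2 := (param c1 y.1, param c2 y.2).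

Fact prod_open_dom : open pdom.
Proof. by apply: openX; exact: open_dom. Qed.

Fact prod_open_codom : open (pcoord @` pdom).
Proof. by rewrite image_prod; apply: openX; exact: open_codom. Qed.

Fact prod_coordK x : pdom x -> pparam (pcoord x) = x.
Proof. by case: x => x1 x2 [/= ? ?]; rewrite /pparam /= !coordK. Qed.

Fact prod_coord_continuous x : pdom x -> {for x, continuous pcoord}.
Proof.
by move=> [? ?]; apply: continuous_prod; exact: coord_continuous.
Qed.

Fact prod_param_continuous y : (pcoord @` pdom) y ->
  {for y, continuous pparam}.
Proof.
rewrite image_prod => -[? ?].
by apply: continuous_prod; exact: param_continuous.
Qed.

Definition prod_chart : chart (T1 * T2)%type (E1 * E2)%type :=
  Chart prod_open_dom prod_open_codom prod_coordK prod_coord_continuous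
    prod_param_continuous.

End ProductChart.

Variables (E1 E2 : normedModType R) (M1 : manifold E1) (M2 : manifold E2).

Let patlas : set (chart (M1 * M2)%type (E1 * E2)%type) :=
  [set c | exists2 c12, atlas c12.1 /\ atlas c12.2 &
                        c = prod_chart c12.1 c12.2].
Let pchart_at (x : M1 * M2) := prod_chart (chart_at x.1) (chart_at x.2).

Fact prod_nonempty : [set: M1 * M2] !=set0.
Proof.
have [x1 _] := manifold_nonempty M1; have [x2 _] := manifold_nonempty M2.
by exists (x1, x2).
Qed.

Fact prod_chart_at_atlas x : patlas (pchart_at x).
Proof.
by exists (chart_at x.1, chart_at x.2) => //; split; exact: chart_at_atlas.
Qed.

Fact prod_chart_at_dom x : dom (pchart_at x) x.
Proof. by split; exact: chart_at_dom. Qed.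

Fact prod_atlas_compat c c' : patlas c -> patlas c' ->
  smooth_on (coord c @` (dom c `&` dom c')) (coord c' \o param c).
Proof.
move=> [[c1 c2] [/= a1 a2] ->] [[c1' c2'] [/= a1' a2'] ->].
rewrite [X in smooth_on (_ @` X)](_ : _ =
  (dom c1 `&` dom c1') `*` (dom c2 `&` dom c2')); last by rewrite setXI.
rewrite image_prod.
apply: (smooth_on_prod _ _ (atlas_compat a1 a1') (atlas_compat a2 a2'));
  by apply: open_chart_image; exact: open_dom.
Qed.

Definition prod_manifold : manifold (E1 * E2)%type :=
  Manifold prod_nonempty
    (hausdorff_prod (@manifold_hausdorff _ _ M1) (@manifold_hausdorff _ _ M2))
    (second_countable_prod (@manifold_second_countable _ _ M1)
       (@manifold_second_countable _ _ M2))
    prod_chart_at_atlas prod_chart_at_dom prod_atlas_compat.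

End Product.

Section TangentSpaces.
Context {R : realType} {E : normedModType R}.

(* The tangent space at x, identified with the model space E by means of the
   preferred chart at x. *)
Definition tangent (M : manifold E) (x : M) : normedModType R := E.

(* The differential at x of a map into a normed space.  In particular,
   [dmap (coord c) x v] is the vector of components of [v] in the chart [c]. *)
Definition dmap (M : manifold E) (W : normedModType R) (h : M -> W) (x : M)
    (v : tangent x) : W :=
  'd (h \o param (chart_at x)) (coord (chart_at x) x) v.

Variable M : manifold E.

Definition vector_field := forall x : M, tangent x.

Definition smooth_fun (W : normedModType R) (V : set M) (h : M -> W) : Prop :=
  forall c : chart M E, atlas c ->
    smooth_on (coord c @` (dom c `&` V)) (h \o param c).

Definition smooth_field (V : set M) (X : vector_field) : Prop :=
  forall c : chart M E, atlas c ->
    smooth_on (coord c @` (dom c `&` V))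
              (fun y => dmap (coord c) (X (param c y))).

(* X h *)
Definition lie_derivative (X : vector_field) (h : M -> R) : M -> R :=
  fun x => dmap h (X x).

(* Z = [X, Y] on V *)
Definition is_lie_bracket (V : set M) (X Y Z : vector_field) : Prop :=
  forall h : M -> R, smooth_fun V h -> forall x, V x ->
    lie_derivative Z h x = lie_derivative X (lie_derivative Y h) x -
                           lie_derivative Y (lie_derivative X h) x.

Definition form2 := forall x : M, tangent x -> tangent x -> R.

Record riemannian_metric (g : form2) : Prop := {
  metric_linear : forall x (u : tangent x), scalar (g x u) ;
  metric_sym : forall x (u v : tangent x), g x u v = g x v u ;
  metric_pos : forall x (v : tangent x), v != 0 -> 0 < g x v v ;
  metric_smooth : forall (V : set M) (X Y : vector_field), open V ->
    smooth_field V X -> smooth_field V Y ->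
    smooth_fun V (fun x => g x (X x) (Y x))
}.

Definition endo := forall x : M, tangent x -> tangent x.

Record tensor11 (J : endo) : Prop := {
  tensor11_linear : forall x, linear (J x) ;
  tensor11_smooth : forall (V : set M) (X : vector_field), open V ->
    smooth_field V X -> smooth_field V (fun x => J x (X x))
}.

(* A linear connection, as an operator on the vector fields that are smooth on
   an open set V; values where the arguments are not smooth are irrelevant. *)
Record connection (nabla : vector_field -> vector_field -> vector_field) :
    Prop := {
  connection_smooth : forall (V : set M) (X Y : vector_field), open V ->
    smooth_field V X -> smooth_field V Y -> smooth_field V (nabla X Y) ;
  connection_local : forall (V : set M) (X X' Y Y' : vector_field), open V ->
    smooth_field V X -> smooth_field V X' ->
    smooth_field V Y -> smooth_field V Y' ->
    (forall x, V x -> X x = X' x) -> (forall x, V x -> Y x = Y' x) ->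
    forall x, V x -> nabla X Y x = nabla X' Y' x ;
  connection_addl : forall (V : set M) (X X' Y : vector_field), open V ->
    smooth_field V X -> smooth_field V X' -> smooth_field V Y ->
    forall x, V x ->
      nabla (fun z => X z + X' z) Y x = nabla X Y x + nabla X' Y x ;
  connection_scalel : forall (V : set M) (h : M -> R) (X Y : vector_field),
    open V -> smooth_fun V h -> smooth_field V X -> smooth_field V Y ->
    forall x, V x -> nabla (fun z => h z *: X z) Y x = h x *: nabla X Y x ;
  connection_addr : forall (V : set M) (X Y Y' : vector_field), open V ->
    smooth_field V X -> smooth_field V Y -> smooth_field V Y' ->
    forall x, V x ->
      nabla X (fun z => Y z + Y' z) x = nabla X Y x + nabla X Y' x ;
  connection_leibniz : forall (V : set M) (h : M -> R) (X Y : vector_field),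
    open V -> smooth_fun V h -> smooth_field V X -> smooth_field V Y ->
    forall x, V x ->
      nabla X (fun z => h z *: Y z) x =
      lie_derivative X h x *: Y x + h x *: nabla X Y x
}.

Definition torsion_free (nabla : vector_field -> vector_field -> vector_field)
    : Prop :=
  forall (V : set M) (X Y : vector_field), open V ->
    smooth_field V X -> smooth_field V Y ->
    is_lie_bracket V X Y (fun x => nabla X Y x - nabla Y X x).

Definition metric_compatible (g : form2)
    (nabla : vector_field -> vector_field -> vector_field) : Prop :=
  forall (V : set M) (X Y Z : vector_field), open V ->
    smooth_field V X -> smooth_field V Y -> smooth_field V Z ->
    forall x, V x ->
      lie_derivative X (fun z => g z (Y z) (Z z)) x =
      g x (nabla X Y x) (Z x) + g x (Y x) (nabla X Z x).

Definition levi_civita (g : form2)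
    (nabla : vector_field -> vector_field -> vector_field) : Prop :=
  [/\ connection nabla, torsion_free nabla & metric_compatible g nabla].

(* nabla J = 0 *)
Definition parallel (nabla : vector_field -> vector_field -> vector_field)
    (J : endo) : Prop :=
  forall (V : set M) (X Y : vector_field), open V ->
    smooth_field V X -> smooth_field V Y ->
    forall x, V x -> nabla X (fun z => J z (Y z)) x - J x (nabla X Y x) = 0.

Record metallic_riemannian (p q : nat) (g : form2) (J : endo) : Prop := {
  metallic_metric : riemannian_metric g ;
  metallic_tensor : tensor11 J ;
  metallic_eq : forall x (v : tangent x),
    J x (J x v) = p%:R *: J x v + q%:R *: v ;
  metallic_compat : forall x (u v : tangent x), g x (J x u) v = g x u (J x v)
}.

(* The Levi-Civita connection exists and is unique (on smooth fields), so that
   the existential quantifier only names it.  p = q = 1 is the Golden case. *)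
Definition locally_metallic (p q : nat) (g : form2) (J : endo) : Prop :=
  metallic_riemannian p q g J /\
  exists nabla, levi_civita g nabla /\ parallel nabla J.

End TangentSpaces.

Section Maps.
Context {R : realType} {E E' : normedModType R}.
Variables (M : manifold E) (N : manifold E').

Definition smooth_map (F : M -> N) : Prop :=
  continuous F /\
  forall (c : chart M E) (c' : chart N E'), atlas c -> atlas c' ->
    smooth_on (coord c @` (dom c `&` F @^-1` dom c')) (coord c' \o F \o param c).

Definition tangent_map (F : M -> N) (x : M) : tangent x -> tangent (F x) :=
  @dmap _ _ M _ (coord (chart_at (F x)) \o F) x.

Definition pullback (F : M -> N) (g : form2 N) : form2 M :=
  fun x u v => g (F x) (tangent_map F u) (tangent_map F v).

Definition isometric_immersion (gM : form2 M) (gN : form2 N) (F : M -> N) :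
    Prop :=
  [/\ smooth_map F, forall x, injective (@tangent_map F x) &
      forall x (u v : tangent x), pullback F gN u v = gM x u v].

Definition distribution := forall x : M, set (tangent x).

Variables (F : M -> N) (gN : form2 N) (J : endo N).

Definition normal_space (x : M) : set (tangent (F x)) :=
  [set w | forall u : tangent x, @gN (F x) w (tangent_map F u) = 0].

(* J D = D, where D is viewed in the tangent spaces of N by means of dF *)
Definition invariant (D : distribution) : Prop :=
  forall x, @J (F x) @` (@tangent_map F x @` D x) = @tangent_map F x @` D x.

Definition anti_invariant (D : distribution) : Prop :=
  forall x, @J (F x) @` (@tangent_map F x @` D x) `<=` @normal_space x.

End Maps.

Section WarpedProduct.
Context {R : realType} {E1 E2 : normedModType R}.
Variables (M1 : manifold E1) (M2 : manifold E2).

Let M := prod_manifold M1 M2.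
Let pi1 : M -> M1 := fst.
Let pi2 : M -> M2 := snd.

Definition warped_metric (g1 : form2 M1) (g2 : form2 M2) (f : M1 -> R) :
    form2 M :=
  fun x u v => pullback pi1 g1 u v + (f (pi1 x)) ^+ 2 * pullback pi2 g2 u v.

Definition tangent_first : distribution M :=
  fun x => [set u | tangent_map pi2 u = 0].

Definition tangent_second : distribution M :=
  fun x => [set u | tangent_map pi1 u = 0].

Record warped_product_submanifold (E : normedModType R) (N : manifold E)
    (gN : form2 N) (g1 : form2 M1) (g2 : form2 M2) (f : M1 -> R) (F : M -> N) :
    Prop := {
  warped_metric1 : riemannian_metric g1 ;
  warped_metric2 : riemannian_metric g2 ;
  warping_smooth : smooth_fun [set: M1] f ;
  warping_pos : forall x, 0 < f x ;
  warped_isometric : isometric_immersion (warped_metric g1 g2 f) gN F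
}.

Record warped_product_semi_invariant (E : normedModType R) (N : manifold E)
    (gN : form2 N) (J : endo N) (g1 : form2 M1) (g2 : form2 M2) (f : M1 -> R)
    (F : M -> N) : Prop := {
  semi_invariant_warped : warped_product_submanifold gN g1 g2 f F ;
  semi_invariant_first : invariant F J tangent_first ;
  semi_invariant_second : anti_invariant F gN J tangent_second
}.

End WarpedProduct.

(* Main.v *)
From HB Require Import structures.
From mathcomp Require Import all_boot all_order all_algebra.
From mathcomp Require Import all_classical all_reals.
From mathcomp Require Import topology normedtype.
From mathcomp Require Import landau derive ring lra.
Require Import Defs.

Set Implicit Arguments.
Unset Strict Implicit.
Unset Printing Implicit Defensive.

Import Order.TTheory GRing.Theory Num.Theory.
Import numFieldNormedType.Exports.
Local Open Scope classical_set_scope.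
Local Open Scope ring_scope.

(** Write g for the metric of the ambient manifold and nabla for its Levi-Civita
connection.  Since J is self-adjoint and parallel, the twisted form
K(u, v) = g(J u, v) is, like g, a parallel symmetric bilinear form.  For the
immersion F and constant coordinate directions u, v of the product chart, write
F_u for the derivative of F along u and nabla_u F_v for the covariant derivative
along F; the latter is symmetric in u and v because nabla is torsion-free and
second derivatives commute.

Fix a direction w of the invariant factor and a direction b of the anti-invariant
one.  At the given point, invariance yields a tangent vector a of the product with
J F_a = F_w, so that K(F_a, -) = g(F_w, -) there.  In a neighbourhood of the point,
anti-invariance says K(F_b, F_b) = 0 and K(F_a, F_b) = 0, and orthogonality of the
two factors says g(F_w, F_b) = 0.  Differentiating these three identities along a,
b and b respectively gives, at the point,

   2 K(nabla_a F_b, F_b) = 0,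
   K(nabla_b F_a, F_b) + g(F_w, nabla_b F_b) = 0,
   g(nabla_b F_w, F_b) + g(F_w, nabla_b F_b) = 0.

By the symmetry of nabla_u F_v the first two give g(F_w, nabla_b F_b) = 0, and then
the third gives g(nabla_w F_b, F_b) = 0: the squared length of F_b is stationary
along w ([normal_direction_critical]).  In a warped product that squared length is
f^2 times a positive factor independent of the first coordinate, hence df(w) = 0
([warping_critical]).  As w is arbitrary, df = 0, and f is locally constant.

The whole computation takes place in charts.  The connection enters only through
its values on coordinate fields at one point, the Christoffel symbols: [parallel_form]
records what parallelism says about them, and this suffices because only first
derivatives of g and K along F occur. *)

(** * Calculus of maps of class C^k *)

Section Ck_calculus.
Context {R : realType}.
Implicit Types E F : normedModType R.

Lemma CkW E F k (U : set E) (f : E -> F) : Ck k.+1 U f -> Ck k U f.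
Proof.
elim: k f => [|k IH] f [df Cf].
  by move=> x Ux; apply: differentiable_continuous; apply: df.
by split=> // v; apply: IH; apply: Cf.
Qed.

Lemma Ck_cst E F k (U : set E) (a : F) : open U -> Ck k U (fun=> a).
Proof.
move=> oU; elim: k a => [|k IH] a /=; first by move=> x _; exact: cst_continuous.
split=> [x _|v]; first exact: differentiable_cst.
apply: eq_Ck (IH 0) => // x _.
by have /= -> := diff_cst a x.
Qed.

Lemma CkD E F k (U : set E) (f g : E -> F) : open U ->
  Ck k U f -> Ck k U g -> Ck k U (f \+ g).
Proof.
move=> oU; elim: k f g => [|k IH] f g /=.
  by move=> cf cg x Ux; apply: cvgD; [exact: cf|exact: cg].
move=> [df Cf] [dg Cg]; split=> [x Ux|v].
  by apply: differentiableD; [exact: df|exact: dg].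
apply: eq_Ck (IH _ _ (Cf v) (Cg v)) => // x Ux.
by rewrite (diffD (df _ Ux) (dg _ Ux)).
Qed.

Lemma Ck_sum E F k (U : set E) m (f : 'I_m -> E -> F) : open U ->
  (forall i, Ck k U (f i)) -> Ck k U (fun x => \sum_i f i x).
Proof.
move=> oU Cf; elim: m f Cf => [|m IH] f Cf.
  by apply: eq_Ck (Ck_cst k 0 oU) => // x _; rewrite big_ord0.
apply: eq_Ck (CkD oU (IH _ (fun i => Cf (widen_ord (leqnSn m) i))) (Cf ord_max)) => // x _.
by rewrite big_ord_recr.
Qed.

Lemma Ck_lin_comp E F (H : normedModType R) k (U : set E) (f : E -> F)
    (l : {linear F -> H}) : open U -> continuous l ->
  Ck k U f -> Ck k U (l \o f).
Proof.
move=> oU cl; elim: k f => [|k IH] f /=.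
  by move=> cf x Ux; apply: continuous_comp; [exact: cf|exact: cl].
move=> [df Cf]; have dl x : differentiable l x by exact: linear_differentiable.
split=> [x Ux|v]; first by apply: differentiable_comp => //; exact: df.
apply: eq_Ck (IH _ (Cf v)) => // x Ux /=.
have [_ /= ->] := is_diff_comp (differentiableP (df _ Ux)) (differentiableP (dl (f x))).
by rewrite /= diff_lin.
Qed.

Fact scale_is_bilinear F :
  bilinear_for
    (GRing.Scale.Law.clone _ _ *:%R _) (GRing.Scale.Law.clone _ _ *:%R _)
    (@GRing.scale R F).
Proof.
split=> [u'|u] a x y /=; first by rewrite scalerDl scalerA.
by rewrite scalerDr !scalerA mulrC.
Qed.
HB.instance Definition _ F :=
  bilinear_isBilinear.Build R R F F _ _ (@GRing.scale R F) (scale_is_bilinear F).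

Lemma is_diff_scale E F (h : E -> R) (f : E -> F) x :
  differentiable h x -> differentiable f x ->
  is_diff x (fun x => h x *: f x) (fun v => h x *: 'd f x v + 'd h x v *: f x).
Proof.
move=> dh df; have cs : continuous (fun p : R * F => p.1 *: p.2).
  exact: scale_continuous.
have db := @differentiable_bilin _ _ _ _ (@GRing.scale R F) (h x, f x) cs.
have := is_diff_comp (differentiableP (differentiable_pair dh df))
  (differentiableP db).
by rewrite diff_bilin // diff_pair.
Qed.

Lemma CkZ E F k (U : set E) (h : E -> R) (f : E -> F) : open U ->
  Ck k U h -> Ck k U f -> Ck k U (fun x => h x *: f x).
Proof.
move=> oU; elim: k h f => [|k IH] h f Ch Cf.
  by move=> x Ux; apply: cvgZ; [exact: Ch|exact: Cf].
have [dh Ch'] := Ch; have [df Cf'] := Cf.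
have dhf x (Ux : U x) := is_diff_scale (dh x Ux) (df x Ux).
split=> [x /dhf[]//|v].
apply: eq_Ck (CkD oU (IH _ _ (CkW Ch) (Cf' v)) (IH _ _ (Ch' v) (CkW Cf))) => // x Ux.
by have [_ ->] := dhf _ Ux.
Qed.

(** A named projection, so that it can carry the structure of a linear map. *)
Definition entry n (i : 'I_n) (y : 'rV[R]_n) : R := y 0 i.

Fact entry_is_linear n (i : 'I_n) : linear (@entry n i).
Proof. by move=> a u v; rewrite /entry !mxE. Qed.
HB.instance Definition _ n (i : 'I_n) :=
  GRing.isLinear.Build R 'rV[R]_n R _ (@entry n i) (entry_is_linear i).

Lemma Ck_coord E n k (U : set E) (f : E -> 'rV[R]_n) i : open U ->
  Ck k U f -> Ck k U (@entry n i \o f).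
Proof.
move=> oU; apply: (@Ck_lin_comp _ _ _ k U f (@entry n i)) => //.
exact: matrix_normedtype.coord_continuous.
Qed.

(** The source of g has to be a coordinate space: the derivative of the composite
along v is 'd g (f x) ('d f x v), and class C^k for 'd g is only available along
fixed directions, so the moving vector 'd f x v is expanded in the standard
basis. *)
Lemma Ck_comp E F n k (U : set E) (W : set 'rV[R]_n) (f : E -> 'rV[R]_n)
    (g : 'rV[R]_n -> F) : open U -> open W -> (forall x, U x -> W (f x)) ->
  Ck k U f -> Ck k W g -> Ck k U (g \o f).
Proof.
move=> oU oW UW; elim: k g => [|k IH] g.
  move=> cf cg x Ux; apply: continuous_comp; first exact: cf.
  by apply: cg; apply: UW.
move=> Cf Cg; have [df Cf'] := Cf; have [dg Cg'] := Cg.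
split=> [x Ux|v].
  by apply: differentiable_comp; [exact: df|apply: dg; exact: UW].
have := Ck_sum oU (fun i => CkZ oU (Ck_coord i oU (Cf' v))
  (IH _ (CkW Cf) (Cg' (delta_mx 0 i)))).
apply: eq_Ck => // x Ux.
rewrite (diff_comp (df _ Ux) (dg _ (UW _ Ux))) /=.
rewrite [in RHS](row_sum_delta ('d f x v)) linear_sum.
by apply: eq_bigr => i _; rewrite linearZ.
Qed.

End Ck_calculus.

(** * Symmetry of second derivatives and product rules *)

Section Derivatives.
Context {R : realType}.
Implicit Types E F : normedModType R.

Lemma differentiable_is_derive E F (f : E -> F) x v :
  differentiable f x -> is_derive x v f ('d f x v).
Proof.
move=> df; apply: DeriveDef; first exact: diff_derivable.
exact: deriveE.
Qed.

Lemma is_derive_line E F (f : E -> F) z v (s : R) :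
  differentiable f (s *: v + z) ->
  is_derive s 1 (fun s => f (s *: v + z)) ('d f (s *: v + z) v).
Proof.
move=> df.
have dl : is_diff s (fun s : R => s *: v + z) (fun s => s *: v).
  have d1 := is_diff_scalel s v.
  by have := is_diffD d1 (is_diff_cst z s); rewrite addr0.
have [dc dcE] := is_diff_comp dl (differentiableP df).
have := differentiable_is_derive (1 : R) dc.
by rewrite dcE /= scale1r.
Qed.

(** The second difference of f over the parallelogram of sides t u and t v is t^2
times the second derivative, up to o(t^2).  For fixed t it is the increment over
[0, t] of h s = f (s v + t u + x) - f (s v + x), so the mean value theorem turns it
into t times an increment of 'd f (-) v, which differentiability of 'd f (-) v at x
controls. *)
Lemma second_difference E (f : E -> R) x u v (e : R) : 0 < e ->
  (\forall y \near x, differentiable f y) ->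
  differentiable (fun y => 'd f y v) x ->
  exists2 r, 0 < r & forall t, 0 < t < r ->
    `|f (t *: v + (t *: u + x)) - f (t *: u + x) - f (t *: v + x) + f x
      - t ^+ 2 * 'd (fun y => 'd f y v) x u| <= e * t ^+ 2.
Proof.
move=> e0 df dd.
pose G y : R := 'd f y v.
(* The two points compared with x lie within t (|u| + |v|) and t |v| of it; their
   errors add up to at most t c, the final 1 making c positive. *)
pose c := `|u| + 2 * `|v| + 1.
have c0 : 0 < c by rewrite /c ltr_wpDl // addr_ge0 // mulr_ge0.
have ec0 : 0 < e / c by rewrite divr_gt0.
have := diff_locally dd => /eqaddoP /(_ _ ec0) H.
have df0 : \forall h \near (0 : E), differentiable f (h + x).
  by have := df; rewrite (near_shift 0 x) /=; apply: filterS => h /=; rewrite subr0.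
have [r /= r0 hr] := nbhs_norm0P.1 (filterI H df0).
have hG h : `|h| < r -> `|G (h + x) - G x - 'd G x h| <= e / c * `|h|.
  by move=> /hr [] /=; rewrite /= !fctE /= opprD addrA.
have hd h : `|h| < r -> differentiable f (h + x) by move=> /hr [].
exists (r / c); first by rewrite divr_gt0.
move=> t /andP[t0 tr].
have tc : t * c < r by rewrite -ltr_pdivlMr.
have sm s : 0 <= s <= t -> `|s *: v| <= t * `|v|.
  by move=> /andP[s0 st]; rewrite normrZ ger0_norm // ler_wpM2r.
have tu : `|t *: u| = t * `|u| by rewrite normrZ gtr0_norm.
have nu := normr_ge0 u; have nv := normr_ge0 v.
have sm1 s : 0 <= s <= t -> `|s *: v| < r.
  move=> /sm /le_lt_trans; apply; apply: le_lt_trans tc; rewrite ler_pM2l // /c.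
  lra.
have sm2 s : 0 <= s <= t -> `|s *: v + t *: u| < r.
  move=> /sm h; apply: le_lt_trans (ler_normD _ _) _; rewrite tu.
  apply: le_lt_trans tc; rewrite /c; nra.
pose h s := f (s *: v + (t *: u + x)) - f (s *: v + x).
have dh s : 0 <= s <= t ->
    is_derive s 1 h (G (s *: v + (t *: u + x)) - G (s *: v + x)).
  move=> st; apply: is_deriveB; apply: is_derive_line.
    by rewrite addrA; apply: hd; apply: sm2.
  by apply: hd; apply: sm1.
have [||xi xit] := @MVT _ h (fun s => G (s *: v + (t *: u + x)) - G (s *: v + x)) 0 t t0.
- by move=> s; rewrite in_itv /= => /andP[s0 st]; apply: dh; rewrite !ltW.
- apply: derivable_within_continuous => s; rewrite in_itv /= => st.
  by have [] := dh _ st.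
rewrite /h !scale0r !add0r subr0 => hE.
have {xit} xit : 0 <= xi <= t by move: xit; rewrite in_itv /= => /andP[? ?]; rewrite !ltW.
have -> : f (t *: v + (t *: u + x)) - f (t *: u + x) - f (t *: v + x) + f x
  = f (t *: v + (t *: u + x)) - f (t *: v + x) - (f (t *: u + x) - f x) by ring.
rewrite hE addrA.
have h1 := hG _ (sm1 _ xit); have h2 := hG _ (sm2 _ xit).
set a := G (xi *: v + t *: u + x) in h2 *; set b := G (xi *: v + x) in h1 *.
have mE : 'd G x (xi *: v + t *: u) = 'd G x (xi *: v) + t * 'd G x u.
  by rewrite linearD; congr (_ + _); exact: linearZ_LR.
rewrite {}mE in h2; move: h1 h2.
rewrite -/(G : E -> R); set m := 'd G x u; set m1 := 'd G x (xi *: v) => h1 h2.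
have key : `|a - b - t * m| <= e * t.
  have -> : a - b - t * m = (a - G x - (m1 + t * m)) - (b - G x - m1) by ring.
  apply: le_trans (ler_normB _ _) _; apply: le_trans (lerD h2 h1) _.
  rewrite -mulrDr -[leRHS]mulr1 -(mulVf (lt0r_neq0 c0)) mulrA.
  rewrite [leRHS](_ : _ = e / c * (t * c)); last by ring.
  rewrite ler_pM2l //; have := sm _ xit; have := ler_normD (xi *: v) (t *: u).
  rewrite tu /c; nra.
have -> : (a - b) * t - t ^+ 2 * m = (a - b - t * m) * t by ring.
by rewrite normrM (gtr0_norm t0) expr2 mulrA ler_pM2r.
Qed.

(** The second difference is symmetric in u and v, so both iterated derivatives are
its limit after division by t^2. *)
Lemma diff_diff_sym E (f : E -> R) x u v :
  (\forall y \near x, differentiable f y) ->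
  differentiable (fun y => 'd f y u) x -> differentiable (fun y => 'd f y v) x ->
  'd (fun y => 'd f y v) x u = 'd (fun y => 'd f y u) x v.
Proof.
move=> df du dv; set a := LHS; set b := RHS.
apply/eqP; rewrite -subr_eq0 -normr_eq0; apply/eqP/le_anti; rewrite normr_ge0 andbT.
apply/ler_addgt0Pl => e e0; rewrite addr0.
have e20 : 0 < e / 2 by rewrite divr_gt0.
have [r r0 hr] := second_difference u e20 df dv.
have [s s0 hs] := second_difference v e20 df du.
pose t := Num.min r s / 2.
have m0 : 0 < Num.min r s by rewrite lt_min r0.
have t0 : 0 < t by rewrite divr_gt0.
have tm : t < Num.min r s by rewrite /t; lra.
have /andP[tr ts] : (t < r) && (t < s) by rewrite -lt_min.
have := hr t; have := hs t; rewrite t0 tr ts => /(_ isT) h1 /(_ isT) h2.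
rewrite -(ler_pM2r (exprn_gt0 2 t0)).
rewrite -[leLHS](_ : `|(a - b) * t ^+ 2| = _); last first.
  by rewrite normrM [X in _ * X]gtr0_norm // exprn_gt0.
have -> : e * t ^+ 2 = e / 2 * t ^+ 2 + e / 2 * t ^+ 2 by field.
apply: le_trans (lerD h1 h2).
rewrite [_ + (_ + x)]addrCA.
rewrite -/a -/b distrC [X in _ <= _ + X]distrC.
apply: le_trans (ler_normB _ _); rewrite le_eqVlt; apply/orP; left; apply/eqP.
by rewrite distrC; congr (`| _ |); ring.
Qed.

Lemma diff_entry E n (f : E -> 'rV[R]_n) x i : differentiable f x ->
  is_diff x (@entry R n i \o f) (@entry R n i \o 'd f x).
Proof.
move=> df; have dl : is_diff (f x) (@entry R n i) (@entry R n i).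
  apply: DiffDef; last by apply: diff_lin; exact: matrix_normedtype.coord_continuous.
  exact: differentiable_coord.
exact: is_diff_comp.
Qed.

Lemma diff_diff_sym_row E n (f : E -> 'rV[R]_n) x u v :
  (\forall y \near x, differentiable f y) ->
  differentiable (fun y => 'd f y u) x -> differentiable (fun y => 'd f y v) x ->
  'd (fun y => 'd f y v) x u = 'd (fun y => 'd f y u) x v.
Proof.
move=> df du dv; apply/rowP => i.
have E1 w : {near x, @entry R n i \o (fun y => 'd f y w) =1
                 (fun y => 'd (@entry R n i \o f) y w)}.
  by apply: filterS df => y dfy /=; have [_ ->] := diff_entry i dfy.
have [/= du1 duE] := diff_entry i du; have [/= dv1 dvE] := diff_entry i dv.
have [du2 duE2] := near_diff (E1 u) du1.
have [dv2 dvE2] := near_diff (E1 v) dv1.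
have dfi : \forall y \near x, differentiable (@entry R n i \o f) y.
  by apply: filterS df => y dfy /=; have [] := diff_entry i dfy.
have := diff_diff_sym dfi du2 dv2.
by rewrite dvE2 duE2 dvE duE.
Qed.

Lemma scalar_sum_delta n (h : 'rV[R]_n -> R) v : scalar h ->
  h v = \sum_i v 0 i * h (delta_mx 0 i).
Proof.
move=> lh; pose l : {scalar 'rV[R]_n} :=
  HB.pack h (GRing.isLinear.Build _ _ _ _ h lh).
rewrite {1}[v]row_sum_delta -[LHS]/(l _) linear_sum.
by apply: eq_bigr => i _; rewrite linearZ.
Qed.

(** The product rule for the application of a moving linear form to a moving vector.
Expanding the vector in the standard basis reduces it to the form on fixed vectors. *)
Lemma is_derive_apply E n (B : E -> 'rV[R]_n -> R) (D : 'rV[R]_n -> R)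
    (V : E -> 'rV[R]_n) (V' : 'rV[R]_n) x e :
  (forall y, scalar (B y)) -> (forall v, is_derive x e (B ^~ v) (D v)) ->
  is_derive x e V V' ->
  is_derive x e (fun y => B y (V y)) (D (V x) + B x V').
Proof.
move=> lB dB dV; pose e_ i : 'rV[R]_n := delta_mx 0 i.
have BE y v : B y v = \sum_i v 0 i * B y (e_ i) by exact: scalar_sum_delta.
(* D is linear, as the derivative of a family of linear forms. *)
have DE v : D v = \sum_i v 0 i * D (e_ i).
  have [_ <-] := dB v; rewrite (_ : B ^~ v = \sum_i (v 0 i \*: B ^~ (e_ i))).
    by have [_ ->] := is_derive_sum (fun i => is_deriveZ (v 0 i) (dB (e_ i))).
  by rewrite fct_sumE; apply/funext => y; rewrite BE.
have [/[dup] Vx /derivable_mxP Vi VE] := dV.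
have dVi i : is_derive x e (fun y => V y 0 i) (V' 0 i).
  by apply: DeriveDef => //; rewrite -VE derive_mx // mxE.
have := is_derive_sum (fun i => is_deriveM (dVi i) (dB (e_ i))).
rewrite fct_sumE big_split /= -DE [in X in _ + X](_ : \sum_i _ = B x V').
  by congr is_derive; apply/funext => y; rewrite BE.
by rewrite BE; apply: eq_bigr => i _; exact: mulrC.
Qed.

Lemma diff0_ball_constant E (f : E -> R) x (r : R) :
  (forall y, ball x r y -> differentiable f y /\ forall v, 'd f y v = 0) ->
  forall y, ball x r y -> f y = f x.
Proof.
move=> df y xy.
have seg s : 0 <= s <= 1 -> ball x r (s *: (y - x) + x).
  move=> /andP[s0 s1]; move: xy; rewrite -!ball_normE /=.
  rewrite opprD addrCA subrr addr0 normrN normrZ [`|y - x|]distrC ger0_norm //.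
  by apply: le_lt_trans; rewrite ler_piMl.
pose h s := f (s *: (y - x) + x).
have dh (s : R) : 0 <= s <= 1 -> is_derive s 1 h 0.
  move=> /seg /df [d0 dE]; rewrite -[0](dE (y - x)); exact: is_derive_line.
have [||xi _] := @MVT _ h (fun=> 0) 0 1 ltr01.
- by move=> s; rewrite in_itv /= => /andP[s0 st]; apply: dh; rewrite !ltW.
- apply: derivable_within_continuous => s; rewrite in_itv /= => st.
  by have [] := dh _ st.
by rewrite /h scale1r scale0r subrK add0r mul0r => /eqP; rewrite subr_eq0 => /eqP.
Qed.

End Derivatives.

(** * Parallel forms along a map, in coordinates *)

Section Parallel.
Context {R : realType} {E : normedModType R} {n : nat}.
Implicit Types (B : 'rV[R]_n -> 'rV[R]_n -> 'rV[R]_n -> R).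

(** Parallelism at the single point z of a field B of symmetric bilinear forms, for
the connection whose Christoffel symbol at z is Gam, the product rule for
nabla B = 0 being spelled out on constant fields. *)
Record parallel_form (Gam : 'rV[R]_n -> 'rV[R]_n -> 'rV[R]_n) B (z : 'rV[R]_n) :
    Prop := ParallelForm {
  parallel_linear : forall y u, scalar (B y u) ;
  parallel_sym : forall y u v, B y u v = B y v u ;
  parallel_diff : forall u v, differentiable (fun y => B y u v) z ;
  parallel_eq : forall u v w,
    'd (fun y => B y u v) z w = B z (Gam w u) v + B z u (Gam w v)
}.

Variables (Gam : 'rV[R]_n -> 'rV[R]_n -> 'rV[R]_n) (phi : E -> 'rV[R]_n) (x : E).
Hypothesis Gam_sym : forall u v, Gam u v = Gam v u.
Hypothesis diff_phi : \forall y \near x, differentiable phi y.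
Hypothesis diff_dphi : forall u, differentiable (fun y => 'd phi y u) x.

(** The covariant derivative at x, in the direction e, of the field 'd phi (-) u
along phi. *)
Definition cov_deriv (e u : E) : 'rV[R]_n :=
  'd (fun y => 'd phi y u) x e + Gam ('d phi x e) ('d phi x u).

Lemma cov_deriv_sym u v : cov_deriv u v = cov_deriv v u.
Proof.
congr (_ + _); last exact: Gam_sym.
exact: (diff_diff_sym_row diff_phi (diff_dphi u) (diff_dphi v)).
Qed.

Lemma is_derive_parallel B e u v : parallel_form Gam B (phi x) ->
  is_derive x e (fun y => B (phi y) ('d phi y u) ('d phi y v))
    (B (phi x) (cov_deriv e u) ('d phi x v) + B (phi x) ('d phi x u) (cov_deriv e v)).
Proof.
move=> pB; have dphi := nbhs_singleton diff_phi.
have lB y w : scalar (B y w) by exact: parallel_linear pB _ _.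
have BD y w w1 w2 : B y w (w1 + w2) = B y w w1 + B y w w2.
  by have := lB y w 1 w1 w2; rewrite scale1r mul1r.
have Bsym := parallel_sym pB.
have dV w := differentiable_is_derive e (diff_dphi w).
have dB w w' : is_derive x e (fun y => B (phi y) w w')
    (B (phi x) (Gam ('d phi x e) w) w' + B (phi x) w (Gam ('d phi x e) w')).
  have [dc dcE] := is_diff_comp (differentiableP dphi)
    (differentiableP (parallel_diff pB w w')).
  by have := differentiable_is_derive e dc; rewrite dcE /= (parallel_eq pB).
have dB1 w : is_derive x e (fun y => B (phi y) w ('d phi y v))
   (B (phi x) (Gam ('d phi x e) w) ('d phi x v) + B (phi x) w (cov_deriv e v)).
  apply: is_derive_eq (is_derive_apply (fun y => lB (phi y) w) (dB w) (dV v)) _.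
  by rewrite /cov_deriv BD -addrA; congr (_ + _); exact: addrC.
have lB' y : scalar (fun w => B (phi y) w ('d phi y v)).
  by move=> k w1 w2; rewrite !(Bsym _ _ ('d phi y v)); exact: lB.
apply: is_derive_eq (is_derive_apply lB' dB1 (dV u)) _.
rewrite addrAC; congr (_ + _).
by rewrite !(Bsym _ _ ('d phi x v)) -BD addrC.
Qed.

Lemma is_derive_near0 (h : E -> R) e d : (\forall y \near x, h y = 0) ->
  is_derive x e h d -> d = 0.
Proof.
move=> h0 [dh <-].
by rewrite (@near_eq_derive _ _ _ h (cst 0)) ?derive_cst.
Qed.

(** The heart of the argument.  G stands for the metric, K for its twist by J; b is
the direction of the anti-invariant factor, a' that of the invariant one, and a is
the direction that J carries to a' at x.  The three vanishing hypotheses are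
differentiated along a, b and b; the symmetry of the covariant derivative then
relates the results. *)
Lemma normal_direction_critical (G K : 'rV[R]_n -> 'rV[R]_n -> 'rV[R]_n -> R) (a a' b : E) :
  parallel_form Gam G (phi x) -> parallel_form Gam K (phi x) ->
  (\forall y \near x, K (phi y) ('d phi y b) ('d phi y b) = 0) ->
  (\forall y \near x, K (phi y) ('d phi y a) ('d phi y b) = 0) ->
  (\forall y \near x, G (phi y) ('d phi y a') ('d phi y b) = 0) ->
  (forall w, K (phi x) ('d phi x a) w = G (phi x) ('d phi x a') w) ->
  is_derive x a' (fun y => G (phi y) ('d phi y b) ('d phi y b)) 0.
Proof.
move=> pG pK Kbb Kab Gab KG.
have K1 := is_derive_near0 Kbb (is_derive_parallel a b b pK).
have K2 := is_derive_near0 Kab (is_derive_parallel b a b pK).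
have G1 := is_derive_near0 Gab (is_derive_parallel b a' b pG).
apply: is_derive_eq (is_derive_parallel a' b b pG) _.
rewrite cov_deriv_sym (parallel_sym pG _ _ (cov_deriv b a')).
rewrite cov_deriv_sym (parallel_sym pK _ _ (cov_deriv b a)) in K1.
rewrite KG in K2.
move: G1 K1 K2.
move: (G _ (cov_deriv b a') _) (G _ _ (cov_deriv b b)) (K _ (cov_deriv b a) _) => g1 g2 k.
lra.
Qed.

End Parallel.

(** * Coordinate fields *)

Section Charts.
Context {R : realType} {E : normedModType R} {M : manifold E}.
Implicit Types (c : chart M E) (x : M) (u v : E).

Lemma near_coord c x (P : M -> Prop) : dom c x ->
  (\forall z \near x, P z) -> \forall y \near coord c x, P (param c y).
Proof.
move=> cx nP; have := @param_continuous _ _ _ c (coord c x).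
rewrite /prop_for /continuous_at coordK //; apply=> //; by exists x.
Qed.

Lemma near_coordK c x : dom c x -> \forall y \near coord c x, coord c (param c y) = y.
Proof.
move=> cx; apply: (@filterS _ _ _ (coord c @` dom c)); last first.
  by apply: open_nbhs_nbhs; split; [exact: open_codom|exists x].
by move=> _ [z cz <-]; rewrite coordK.
Qed.

Lemma near_dom c x : dom c x -> \forall z \near x, dom c z.
Proof. by move=> cx; apply: open_nbhs_nbhs; split=> //; exact: open_dom. Qed.

Lemma near_coord_dom c x : dom c x ->
  \forall y \near coord c x, dom c (param c y) /\ coord c (param c y) = y.
Proof.
move=> cx; apply: filterI; last exact: near_coordK.
by apply: near_coord => //; exact: near_dom.
Qed.

Lemma near_chart_image c x V : dom c x -> open V -> V x ->
  \forall y \near coord c x, (coord c @` (dom c `&` V)) y.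
Proof.
move=> cx oV Vx; apply: open_nbhs_nbhs; split; last by exists x.
exact: open_chart_image.
Qed.

(** The field with constant components u in the chart c.  Tangent vectors at x being
components in the preferred chart at x, the field is given there by the derivative of
the change of charts. *)
Definition coord_field c u : vector_field M :=
  fun x => 'd (coord (chart_at x) \o param c) (coord c x) u.

Lemma differentiable_transition c c' x : atlas c -> atlas c' ->
  dom c x -> dom c' x -> differentiable (coord c' \o param c) (coord c x).
Proof. by move=> ac ac' cx cx'; have [+ _] := atlas_compat ac ac' 1; apply; exists x. Qed.

(** Differentiability may be tested in any chart: the atlas is smooth and the two
expressions of h differ by a change of charts. *)
Lemma is_diff_chart (W : normedModType R) (h : M -> W) c c' x :
  atlas c -> atlas c' -> dom c x -> dom c' x ->
  differentiable (h \o param c') (coord c' x) ->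
  is_diff (coord c x) (h \o param c)
    ('d (h \o param c') (coord c' x) \o 'd (coord c' \o param c) (coord c x)).
Proof.
move=> ac ac' cx cx' dh; have dt := differentiable_transition ac ac' cx cx'.
have dh' : differentiable (h \o param c') ((coord c' \o param c) (coord c x)).
  by rewrite /= coordK.
have [|d dE] := near_diff (g := h \o param c) _ (differentiable_comp dt dh').
  apply: filterS (near_coord cx (near_dom cx')) => y c'y /=.
  by rewrite coordK.
by apply: DiffDef => //; rewrite dE diff_comp //= coordK.
Qed.

Lemma dmap_coord_field (W : normedModType R) (h : M -> W) c x u :
  atlas c -> dom c x -> differentiable (h \o param c) (coord c x) ->
  dmap h (coord_field c u x) = 'd (h \o param c) (coord c x) u.
Proof.
move=> ac cx dh; have ax := chart_at_atlas x; have xx := chart_at_dom x.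
have [d _] := is_diff_chart ax ac xx cx dh.
by have [_ ->] := is_diff_chart ac ax cx xx d.
Qed.

Lemma diff_coord_param c x : dom c x -> is_diff (coord c x) (coord c \o param c) id.
Proof.
move=> cx; have [|d dE] := near_diff (g := coord c \o param c) _
  (@ex_diff _ _ _ _ _ _ _ (is_diff_id (coord c x))).
  by apply: filterS (near_coordK cx) => y /= ->.
by apply: DiffDef => //; rewrite dE; apply: diff_val.
Qed.

Lemma coord_field_at x u : coord_field (chart_at x) u x = u.
Proof. by rewrite /coord_field; have [_ ->] := diff_coord_param (chart_at_dom x). Qed.

Lemma dmap_coord c c' x u : atlas c -> atlas c' -> dom c x -> dom c' x ->
  dmap (coord c') (coord_field c u x) = 'd (coord c' \o param c) (coord c x) u.
Proof.
by move=> ac ac' cx cx'; rewrite dmap_coord_field //; exact: differentiable_transition.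
Qed.

End Charts.

(** The coordinate expression of F computes its tangent map at every point of the two
chart domains, although tangent vectors are represented in preferred charts that vary
from point to point. *)
Lemma tangent_map_coord_field (R : realType) (E E' : normedModType R)
    (M : manifold E) (N : manifold E') (F : M -> N) (c : chart M E)
    (c' : chart N E') x (dphi : E -> E') u :
  {for x, continuous F} -> atlas c -> atlas c' -> dom c x -> dom c' (F x) ->
  is_diff (coord c x) (coord c' \o F \o param c) dphi ->
  tangent_map F (coord_field c u x) = coord_field c' (dphi u) (F x).
Proof.
move=> cF ac ac' cx c'Fx [d dE]; rewrite /tangent_map.
have ax := chart_at_atlas (F x); have xx := chart_at_dom (F x).
have dt := differentiable_transition ac' ax c'Fx xx.
have phix : (coord c' \o F \o param c) (coord c x) = coord c' (F x).
  by rewrite /= coordK.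
rewrite -phix in dt.
have [|dh dhE] := near_diff
  (g := coord (chart_at (F x)) \o F \o param c) _ (differentiable_comp d dt).
  have : \forall z \near x, dom c' (F z) by exact: cF (near_dom c'Fx).
  by move=> /(near_coord cx); apply: filterS => y /= c'y; rewrite coordK.
rewrite dmap_coord_field // dhE diff_comp //= dE.
by rewrite /coord_field /= coordK.
Qed.

Section RowCharts.
Context {R : realType} {n : nat} {M : manifold 'rV[R]_n}.
Implicit Types (c : chart M 'rV[R]_n).

Lemma smooth_coord_field c u : atlas c -> smooth_field (dom c) (coord_field c u).
Proof.
move=> ac c' ac' k.
have o1 := open_chart_image c' (open_dom c); have o2 := open_chart_image c (open_dom c').
have [_ /(_ u) C1] := atlas_compat ac ac' k.+1.
have C2 := atlas_compat ac' ac k.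
have sub y : (coord c' @` (dom c' `&` dom c)) y ->
    (coord c @` (dom c `&` dom c')) ((coord c \o param c') y).
  by move=> [x [c'x cx] <-]; exists x => //=; rewrite coordK.
apply: eq_Ck (Ck_comp o1 o2 sub C2 C1) => // _ [x [c'x cx] <-] /=.
by rewrite coordK // dmap_coord.
Qed.

Lemma smooth_coord c i : atlas c ->
  smooth_fun (dom c) (@entry R n i \o coord c).
Proof.
move=> ac c' ac' k; have o1 := open_chart_image c' (open_dom c).
exact: Ck_coord (atlas_compat ac' ac k).
Qed.

End RowCharts.

(** * Parallel forms on a manifold *)

Section ParallelForms.
Context {R : realType} {n : nat} {M : manifold 'rV[R]_n}.
Implicit Types (c : chart M 'rV[R]_n) (B : form2 M).
Variable nabla : vector_field M -> vector_field M -> vector_field M.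

(** The components of B in the chart c, as a field of bilinear forms on the model
space. *)
Definition coord_form B c (y u v : 'rV[R]_n) : R :=
  B (param c y) (coord_field c u (param c y)) (coord_field c v (param c y)).

Definition christoffel x (w u : 'rV[R]_n) : 'rV[R]_n :=
  nabla (coord_field (chart_at x) w) (coord_field (chart_at x) u) x.

(** The bracket of two coordinate fields annihilates the coordinate functions, whose
derivatives along coordinate fields are constant; a vector annihilating all of them
is zero. *)
Lemma christoffel_sym x u v : torsion_free nabla ->
  christoffel x u v = christoffel x v u.
Proof.
move=> tf; set c := chart_at x; have ac : atlas c := chart_at_atlas x.
have cx : dom c x := chart_at_dom x.
have su := smooth_coord_field u ac; have sv := smooth_coord_field v ac.
apply/rowP => i.
have lieE w z : dom c z ->
    lie_derivative (coord_field c w) (@entry R n i \o coord c) z = entry i w.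
  move=> cz; have [d dE] := diff_coord_param cz.
  have [d' dE'] := diff_entry i d.
  by rewrite /lie_derivative dmap_coord_field // dE' /= dE.
have lie0 w w' : lie_derivative (coord_field c w)
    (lie_derivative (coord_field c w') (@entry R n i \o coord c)) x = 0.
  have dc := diff_cst (entry i w') (coord c x).
  have [|d dE] := near_diff (g := lie_derivative (coord_field c w')
     (@entry R n i \o coord c) \o param c) _ (differentiable_cst (entry i w') (coord c x)).
    by apply: filterS (near_coord_dom cx) => y [cy _] /=; rewrite lieE.
  by rewrite /lie_derivative dmap_coord_field // dE dc.
have := tf _ _ _ (open_dom c) su sv _ (smooth_coord i ac) x cx.
rewrite !lie0 subr0.
have [d dE] := diff_coord_param cx; have [d' dE'] := diff_entry i d.
rewrite /lie_derivative /dmap dE' /= dE /entry !mxE => /eqP.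
by rewrite subr_eq0 => /eqP.
Qed.

(** Compatibility of B with nabla, evaluated on coordinate fields at the centre of their
chart.  Positivity is left out so as to cover the twist of a metric by J, which may be
indefinite. *)
Lemma parallel_coord_form B x :
  (forall z (u : tangent z), scalar (B z u)) ->
  (forall z (u v : tangent z), B z u v = B z v u) ->
  (forall (V : set M) (X Y : vector_field M), open V ->
    smooth_field V X -> smooth_field V Y -> smooth_fun V (fun z => B z (X z) (Y z))) ->
  metric_compatible B nabla ->
  parallel_form (christoffel x) (coord_form B (chart_at x)) (coord (chart_at x) x).
Proof.
move=> lB symB sB cB; set c := chart_at x; have ac : atlas c := chart_at_atlas x.
have cx : dom c x := chart_at_dom x.
have dB u v : differentiable (fun y => coord_form B c y u v) (coord c x).
  have [+ _] := sB _ _ _ (open_dom c) (smooth_coord_field u ac)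
    (smooth_coord_field v ac) c ac 1.
  by apply; exists x.
split=> //.
- move=> y u k v w; rewrite /coord_form -lB; congr (B _ _ _).
  by rewrite /coord_field linearP.
- by move=> y u v; rewrite /coord_form symB.
move=> u v w.
have := cB _ _ _ _ (open_dom c) (smooth_coord_field w ac)
  (smooth_coord_field u ac) (smooth_coord_field v ac) x cx.
have /= := dmap_coord_field (h := fun z => B z (coord_field c u z) (coord_field c v z))
  w ac cx (dB u v).
rewrite /lie_derivative => -> ->.
by rewrite /coord_form /christoffel /c coordK // !coord_field_at.
Qed.

Variables (p q : nat) (g : form2 M) (J : endo M).
Hypothesis (gJ : metallic_riemannian p q g J) (gnabla : metric_compatible g nabla).
Hypothesis (Jnabla : parallel nabla J).

Definition twisted : form2 M := fun x u v => @g x (@J x u) v.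

Lemma parallel_metric x : riemannian_metric g ->
  parallel_form (christoffel x) (coord_form g (chart_at x)) (coord (chart_at x) x).
Proof. by move=> [gl gs _ gsm]; exact: parallel_coord_form. Qed.

(** The twist by J is compatible with nabla: in
X g(J Y, Z) = g(nabla_X (J Y), Z) + g(J Y, nabla_X Z), parallelism of J gives
nabla_X (J Y) = J (nabla_X Y). *)
Lemma parallel_twisted x :
  parallel_form (christoffel x) (coord_form twisted (chart_at x)) (coord (chart_at x) x).
Proof.
have [gl gs _ gsm] := metallic_metric gJ; have [_ Js] := metallic_tensor gJ.
apply: parallel_coord_form.
- by move=> z u; exact: gl.
- by move=> z u v; rewrite /twisted gs (metallic_compat gJ).
- by move=> V X Y oV sX sY; apply: (gsm V (fun z => @J z (X z)) Y) => //; exact: Js.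
move=> V X Y Z oV sX sY sZ z Vz.
rewrite (gnabla oV sX (Js _ _ oV sY) sZ Vz); congr (_ + _).
by have /eqP := Jnabla oV sX sY Vz; rewrite subr_eq0 => /eqP ->.
Qed.

End ParallelForms.

(** * Locally constant functions *)

Lemma locally_constant_component (T : topologicalType) (S : Type) (f : T -> S) :
  (forall x, \forall z \near x, f z = f x) ->
  forall x y, connected_component [set: T] x y -> f x = f y.
Proof.
move=> lf x y [C [Cx _ cC] Cy].
pose L := f @^-1` [set f x].
have oL : open L.
  by rewrite openE => z Lz; apply: filterS (lf z) => w; rewrite /L /= => ->.
have cL : closed L.
  rewrite -openC openE => z Lz; rewrite /interior.
  by apply: filterS (lf z) => w fw Lw; apply: Lz; rewrite /L /= -fw.
have CE : C `&` L = C.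
  apply: cC; first by exists x.
  - by exists L.
  - by exists L.
by have [_ /= ->] : (C `&` L) y by rewrite CE.
Qed.

(** The hypothesis concerns each point in its own preferred chart; changing charts, the
derivative in one fixed chart vanishes on a ball. *)
Lemma diff_zero_constant (R : realType) (E : normedModType R) (M : manifold E)
    (f : M -> R) : smooth_fun [set: M] f ->
  (forall x u, 'd (f \o param (chart_at x)) (coord (chart_at x) x) u = 0) ->
  forall x, \forall z \near x, f z = f x.
Proof.
move=> sf df0 x; set c := chart_at x; have ac : atlas c := chart_at_atlas x.
have cx : dom c x := chart_at_dom x.
have df c' z : atlas c' -> dom c' z -> differentiable (f \o param c') (coord c' z).
  by move=> ac' c'z; have [+ _] := sf c' ac' 1; apply; exists z.
have nb : \forall y \near coord c x, differentiable (f \o param c) y /\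
    forall v, 'd (f \o param c) y v = 0.
  apply: filterS (near_coord_dom cx) => y [cy <-]; split; first exact: df.
  move=> v; have az := chart_at_atlas (param c y).
  have zz := chart_at_dom (param c y).
  have [_ ->] := is_diff_chart ac az cy zz (df _ _ az zz).
  by rewrite /= df0.
have [r r0 hr] := (nbhs_ballP _ _).1 nb.
have fr := diff0_ball_constant hr.
have nx : \forall z \near x, dom c z /\ ball (coord c x) r (coord c z).
  apply: filterI; first exact: near_dom.
  by apply: (coord_continuous cx); exact: nbhsx_ballx.
by apply: filterS nx => z [cz /fr]; rewrite /= !coordK.
Qed.

(** * Product charts *)

Lemma is_diff_fst (R : realType) (E1 E2 : normedModType R) (x : E1 * E2) :
  is_diff x fst (fst : E1 * E2 -> E1).
Proof.
by apply: DiffDef; [apply: linear_differentiable|apply: diff_lin] => ?; exact: cvg_fst.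
Qed.

Lemma is_diff_snd (R : realType) (E1 E2 : normedModType R) (x : E1 * E2) :
  is_diff x snd (snd : E1 * E2 -> E2).
Proof.
by apply: DiffDef; [apply: linear_differentiable|apply: diff_lin] => ?; exact: cvg_snd.
Qed.

Section ProductCharts.
Context {R : realType} {E1 E2 : normedModType R}.
Variables (M1 : manifold E1) (M2 : manifold E2).
Let M := prod_manifold M1 M2.
Variables (c1 : chart M1 E1) (c2 : chart M2 E2).
Hypothesis (a1 : atlas c1) (a2 : atlas c2).
Let cM : chart M (E1 * E2)%type := prod_chart c1 c2.

Lemma atlas_prod : @atlas _ _ M cM.
Proof. by exists (c1, c2). Qed.

Lemma tangent_fst (x : M) u : dom cM x ->
  @tangent_map _ _ _ M M1 fst x (coord_field (M := M) cM u x) = coord_field c1 u.1 x.1.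
Proof.
move=> [/= cx1 cx2].
have cf : {for x, continuous (fst : M -> M1)} by exact: cvg_fst.
apply: (tangent_map_coord_field u (F := fst : M -> M1) (c' := c1) (c := cM)
  (dphi := fst)) => //; first exact: atlas_prod.
have [|d dE] := near_diff (g := coord c1 \o (fst : M -> M1) \o param cM) _
  (@ex_diff _ _ _ _ _ _ _ (is_diff_fst (coord cM x))).
  have := @near_coordK _ _ M cM x (conj cx1 cx2); apply: filterS => y.
  by move=> /(congr1 fst) /= ->.
by apply: DiffDef => //; rewrite dE; have [] := is_diff_fst (coord cM x).
Qed.

Lemma tangent_snd (x : M) u : dom cM x ->
  @tangent_map _ _ _ M M2 snd x (coord_field (M := M) cM u x) = coord_field c2 u.2 x.2.
Proof.
move=> [/= cx1 cx2].
have cf : {for x, continuous (snd : M -> M2)} by exact: cvg_snd.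
apply: (tangent_map_coord_field u (F := snd : M -> M2) (c' := c2) (c := cM)
  (dphi := snd)) => //; first exact: atlas_prod.
have [|d dE] := near_diff (g := coord c2 \o (snd : M -> M2) \o param cM) _
  (@ex_diff _ _ _ _ _ _ _ (is_diff_snd (coord cM x))).
  have := @near_coordK _ _ M cM x (conj cx1 cx2); apply: filterS => y.
  by move=> /(congr1 snd) /= ->.
by apply: DiffDef => //; rewrite dE; have [] := is_diff_snd (coord cM x).
Qed.

End ProductCharts.

(** Moving along (v, 0) leaves the factor k at its value k x.2, so that both sides have
the same difference quotients. *)
Lemma is_derive_fst_slice (R : realType) (E1 E2 : normedModType R) (h : E1 -> R)
   (k : E2 -> R) (x : E1 * E2) v d :
   is_derive x (v, 0) (fun y => h y.1 * k y.2) d ->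
   is_derive x.1 v (fun s => h s * k x.2) d.
Proof.
move=> [dh dE].
have lineE : (fun t : R => t^-1 *:
      (((fun y => h y.1 * k y.2) \o shift x) (t *: (v, 0)) - h x.1 * k x.2)) =
    (fun t : R => t^-1 *:
      (((fun s => h s * k x.2) \o shift x.1) (t *: v) - h x.1 * k x.2)).
  by apply/funext => t /=; rewrite scaler0 add0r.
split; first by rewrite /derivable -lineE.
by rewrite -dE /derive -lineE.
Qed.

(** * Critical points of the warping function *)

Lemma coord_form_pullback (R : realType) (E : normedModType R) n (M : manifold E)
    (N : manifold 'rV[R]_n) (F : M -> N) (B : form2 N) (c : chart M E)
    (c' : chart N 'rV[R]_n) z u v (phi := coord c' \o F \o param c) :
  {for z, continuous F} -> atlas c -> atlas c' -> dom c z -> dom c' (F z) ->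
  differentiable phi (coord c z) ->
  coord_form B c' (phi (coord c z)) ('d phi (coord c z) u) ('d phi (coord c z) v) =
  pullback F B (coord_field c u z) (coord_field c v z).
Proof.
move=> cF ac ac' cz c'Fz /differentiableP d.
rewrite /pullback !(tangent_map_coord_field _ cF ac ac' cz c'Fz d).
by rewrite /coord_form /phi /= (coordK cz) (coordK c'Fz).
Qed.

Lemma metric0r (R : realType) (E : normedModType R) (M : manifold E)
    (g : form2 M) (x : M) (u : tangent x) : riemannian_metric g -> @g x u 0 = 0.
Proof.
move=> gm; have := metric_linear gm u (-1) 0 0.
by rewrite scaler0 add0r mulN1r addNr.
Qed.

Section WarpingCritical.
Context {R : realType} {p q n nT nperp : nat}.
Hypothesis nperp_gt0 : (0 < nperp)%N.
Variables (Mbar : manifold 'rV[R]_n) (gbar : form2 Mbar) (J : endo Mbar).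
Hypothesis Mbar_metallic : locally_metallic p q gbar J.
Variables (MT : manifold 'rV[R]_nT) (Mperp : manifold 'rV[R]_nperp).
Variables (gT : form2 MT) (gperp : form2 Mperp) (f : MT -> R).
Let M := prod_manifold MT Mperp.
Variable F : M -> Mbar.
Hypothesis semi_inv :
  @warped_product_semi_invariant _ _ _ MT Mperp _ Mbar gbar J gT gperp f F.

(** [normal_direction_critical] for g and its twist, at the point (s, t) for some t in
the second factor; every chart involved is the preferred one, in which components of
vectors at the base point are the vectors themselves. *)
Lemma warping_critical (s : MT) (w : 'rV[R]_nT) :
  'd (f \o param (chart_at s)) (coord (chart_at s) s) w = 0.
Proof.
have [gJ [nabla [[_ tf mc] Jp]]] := Mbar_metallic.
have [wps inv ainv] := semi_inv.
have [gT_metric gperp_metric sf fpos [[cF sF] _ iso]] := wps.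
have [t _] := manifold_nonempty Mperp.
pose p0 : M := (s, t).
pose cM : chart M _ := chart_at p0; pose c := chart_at (F p0).
have aM : atlas cM := chart_at_atlas p0.
have ac : atlas c := chart_at_atlas (F p0).
have cMp : dom cM p0 := chart_at_dom p0.
have cFp : dom c (F p0) := chart_at_dom (F p0).
pose phi := coord c \o F \o param cM; pose x := coord cM p0.
have phix : phi x = coord c (F p0) by rewrite /phi /x /comp (coordK cMp).
pose U : set M := dom cM `&` F @^-1` dom c.
have oFc : open (F @^-1` dom c) by apply: open_comp; [move=> *; exact: cF|exact: open_dom].
have nU : \forall y \near x, (coord cM @` U) y by apply: near_chart_image.
have [dphi ddphi] : Ck 2 (coord cM @` U) phi by exact: sF.
have dphix : \forall y \near x, differentiable phi y by apply: filterS nU => y /dphi.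
have ddphix u : differentiable (fun y => 'd phi y u) x.
  by have [+ _] := ddphi u; apply; exact: nbhs_singleton nU.
have pull (B : form2 Mbar) u v z : U z ->
    coord_form B c (phi (coord cM z)) ('d phi (coord cM z) u) ('d phi (coord cM z) v) =
    pullback F B (coord_field cM u z) (coord_field cM v z).
  move=> Uz; have [cz cFz] := Uz; apply: coord_form_pullback => //; first exact: cF.
  by apply: dphi; exists z.
have near_pull (B : form2 Mbar) u v (k : M -> R) :
    (forall z, U z -> pullback F B (coord_field cM u z) (coord_field cM v z) = k z) ->
    \forall y \near x, coord_form B c (phi y) ('d phi y u) ('d phi y v) = k (param cM y).
  move=> Bk; apply: filterS nU => _ [z Uz <-].
  by rewrite pull // Bk // coordK //; have [] := Uz.
have tfirst z w' : U z -> tangent_map (snd : M -> Mperp) (coord_field cM (w', 0) z) = 0.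
  by move=> [cz _]; rewrite tangent_snd //; [exact: linear0|exact: chart_at_atlas..].
have tsecond z b : U z -> tangent_map (fst : M -> MT) (coord_field cM (0, b) z) = 0.
  by move=> [cz _]; rewrite tangent_fst //; [exact: linear0|exact: chart_at_atlas..].
pose b : 'rV[R]_nperp := const_mx 1.
have b0 : b != 0.
  by apply/eqP => /rowP /(_ (Ordinal nperp_gt0)) /eqP; rewrite !mxE oner_eq0.
pose e2 : 'rV[R]_nT * 'rV[R]_nperp := (0, b).
pose e1 : 'rV[R]_nT * 'rV[R]_nperp := (w, 0).
have Up0 : U p0 by split.
(* By invariance dF(e1), being tangent to the first factor, has a preimage under J. *)
have [_ [a _ <-] Ja] :
    (@J (F p0) @` (@tangent_map _ _ _ M Mbar F p0 @` tangent_first (x:=p0)))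
      (tangent_map F (e1 : tangent p0)).
  by rewrite inv; exists e1 => //; have := tfirst p0 w Up0; rewrite coord_field_at.
(* J dF(e2) is normal to M, and J is self-adjoint. *)
have twist0 u z : U z ->
    pullback F (twisted gbar J) (coord_field cM u z) (coord_field cM e2 z) = 0.
  move=> Uz; rewrite /pullback /twisted (metallic_compat gJ)
    (metric_sym (metallic_metric gJ)).
  apply: (ainv z); exists (tangent_map F (coord_field cM e2 z)) => //.
  exists (coord_field cM e2 z) => //; exact: tsecond.
have gw0 z : U z -> pullback F gbar (coord_field cM e1 z) (coord_field cM e2 z) = 0.
  move=> Uz; rewrite iso /warped_metric /pullback tfirst // tsecond //.
  by rewrite metric0r // (metric_sym gperp_metric) metric0r // mulr0 addr0.
have gb z : U z -> pullback F gbar (coord_field cM e2 z) (coord_field cM e2 z) =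
   f z.1 ^+ 2 * gperp (coord_field (chart_at t) b z.2) (coord_field (chart_at t) b z.2).
  move=> Uz; rewrite iso /warped_metric /pullback tsecond // metric0r // add0r.
  by have [cz _] := Uz; rewrite tangent_snd //; exact: chart_at_atlas.
have pG := parallel_metric mc (F p0) (metallic_metric gJ).
have pK := parallel_twisted gJ mc Jp (F p0).
rewrite -phix in pG pK.
have KG v : coord_form (twisted gbar J) c (phi x) ('d phi x a) v =
    coord_form gbar c (phi x) ('d phi x e1) v.
  rewrite phix /coord_form (coordK cFp) !coord_field_at /twisted.
  by congr (gbar _ _); exact: Ja.
have core := normal_direction_critical (fun u v => christoffel_sym (F p0) u v tf)
  dphix ddphix pG pK
  (near_pull _ e2 e2 (fun=> 0) (twist0 e2)) (near_pull _ a e2 (fun=> 0) (twist0 a))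
  (near_pull _ e1 e2 (fun=> 0) gw0) KG.
pose f0 := f \o param (chart_at s).
pose k y := @gperp (param (chart_at t) y) (coord_field (chart_at t) b _)
  (coord_field (chart_at t) b _).
have := near_eq_is_derive (near_pull _ e2 e2 _ gb) core.
move=> /(@is_derive_fst_slice _ _ _ (fun y => f0 y ^+ 2) k x w 0) [_ dh].
have df0 : differentiable f0 x.1.
  have [+ _] := sf _ (chart_at_atlas s) 1; apply; exists s => //; split => //.
  exact: chart_at_dom.
have d1 := differentiable_is_derive w df0.
(* Comparing with the product rule, 0 = 2 f (df w) k at (s, t). *)
have [_] := is_deriveM (is_deriveM d1 d1) (is_derive_cst (k x.2) x.1 w).
rewrite (_ : f0 * f0 * cst (k x.2) = fun y => f0 y ^+ 2 * k x.2) // dh.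
have k0 : 0 < k x.2.
  rewrite /k [x.2](_ : _ = coord (chart_at t) t) // coordK; last exact: chart_at_dom.
  by rewrite coord_field_at; exact: metric_pos.
have f0s : 0 < f0 x.1 by exact: fpos.
rewrite scaler0 add0r => /esym dE.
have /eqP : k x.2 * (f0 x.1 * 'd f0 (x.1) w + f0 x.1 * 'd f0 (x.1) w) = 0 by exact: dE.
by rewrite -mulr2n mulf_eq0 mulrn_eq0 mulf_eq0 /= (gt_eqF k0) (gt_eqF f0s) => /eqP.
Qed.

End WarpingCritical.

Theorem theorem1 (R : realType) (p q : nat) (p_gt0 : (0 < p)%N)
    (q_gt0 : (0 < q)%N) (n nT nperp : nat) (nT_gt0 : (0 < nT)%N)
    (nperp_gt0 : (0 < nperp)%N)
    (Mbar : manifold 'rV[R]_n) (gbar : form2 Mbar) (J : endo Mbar)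
    (Mbar_metallic : locally_metallic p q gbar J)
    (MT : manifold 'rV[R]_nT) (Mperp : manifold 'rV[R]_nperp)
    (gT : form2 MT) (gperp : form2 Mperp) (f : MT -> R)
    (F : prod_manifold MT Mperp -> Mbar)
    (M_semi_invariant :
      @warped_product_semi_invariant _ _ _ MT Mperp _ Mbar gbar J gT gperp f F) :
  forall x y : MT, connected_component [set: MT] x y -> f x = f y.
Proof.
apply/locally_constant_component/diff_zero_constant.
  exact: warping_smooth (semi_invariant_warped M_semi_invariant).
move=> s w.
exact (warping_critical nperp_gt0 Mbar_metallic M_semi_invariant s w).
Qed.
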